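(* Let $D:\mathcal{F}_2\to\mathcal{F}_2^*$ be the $\mathbb{F}_2$-linear isomorphism given on bases by $D(S^I)=S_{\bar I}$. Then $$D\circ\chi_{\mathcal{F}_2}=\chi_{\mathcal{F}_2^*}\circ D,$$ where $\chi_{\mathcal{F}_2}$ and $\chi_{\mathcal{F}_2^*}$ are the conjugations of the Hopf algebras $\mathcal{F}_2$ and $\mathcal{F}_2^*$. In particular, $f\in\mathcal{F}_2$ is a conjugation invariant (that is, $\chi_{\mathcal{F}_2}(f)=f$) if and only if $D(f)\in\mathcal{F}_2^*$ is a conjugation invariant (that is, $\chi_{\mathcal{F}_2^*}(D(f))=D(f)$).
   Context: Let $\mathcal{F}_2$ be the free associative unital algebra over $\mathbb{F}_2$ on generators $S^1,S^2,S^3,\ldots$ with degree $|S^i|=i$, and put $S^0=1$. It is a graded connected Hopf algebra with the co-commutative co-product $\Delta(S^n)=\sum_{i=0}^n S^i\otimes S^{n-i}$ (the mod $2$ Leibniz--Hopf algebra). It has the $\mathbb{F}_2$-basis $S^I=S^{i_1}\cdots S^{i_n}$, where $I=(i_1,\ldots,i_n)$ runs over the set $\mathcal{W}$ of all finite sequences of positive integers ($n\ge 0$; $S^{()}=1$). $\mathcal{F}_2^*$ denotes the graded dual Hopf algebra, with dual basis $S_I$, so $\langle S^{I'},S_I\rangle=1$ if $I=I'$ and $0$ otherwise. Its commutative product is dual to $\Delta$, i.e. $\langle S_IS_J,S^K\rangle=\langle S_I\otimes S_J,\Delta(S^K)\rangle$. Its co-product is $\Delta(S_{a_1,\ldots,a_n})=\sum_{i=0}^{n}S_{a_1,\ldots,a_i}\otimes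 S_{a_{i+1},\ldots,a_n}$, where the basis element indexed by the empty sequence is the unit $1$. The conjugation (antipode) $\chi$ of a connected commutative or co-commutative Hopf algebra is the unique linear map with $\chi(1)=1$ and $\sum x'\chi(x'')=0$ whenever $\deg(x)>0$ and $\Delta(x)=\sum x'\otimes x''$. Dual sequence: write $I=(i_1,\ldots,i_l)\in\mathcal{W}$ as a string of $1$'s separated by plus signs and commas, $(\underbrace{1+\cdots+1}_{i_1},\ldots,\underbrace{1+\cdots+1}_{i_l})$. The dual $\bar I\in\mathcal{W}$ is obtained by switching every plus sign to a comma and every comma to a plus sign (the empty sequence is its own dual). For example, $I=(1,3,2)=(1,1+1+1,1+1)$ has $\bar I=(1+1,1,1+1,1)=(2,1,2,1)$. One has $\bar{\bar I}=I$, so $D$ is bijective with $D^{-1}(S_I)=S^{\bar I}$. *)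

(* Defs.v *)
From HB Require Import structures.
From mathcomp Require Import all_boot all_order all_algebra.
From mathcomp Require Import finmap.
From mathcomp.multinomials Require Import monalg.

Set Implicit Arguments.
Unset Strict Implicit.
Unset Printing Implicit Defensive.

Import GRing.Theory.

Local Open Scope ring_scope.

(* {malg F2[K]} is the F2-vector space with basis K; <<k>> is the basis       *)
(* vector indexed by k and x@_k the coefficient of x on it.                   *)
Definition F2 : fieldType := 'F_2.

Section LinearExtension.
Variables (K : choiceType) (V : lmodType F2).

Definition lext (h : K -> V) (x : {malg F2[K]}) : V :=
  \sum_(k <- msupp x) x@_k *: h k.

Lemma lextEw (h : K -> V) (d : {fset K}) x : (msupp x `<=` d)%fset ->
  lext h x = \sum_(k <- d) x@_k *: h k.
Proof.
move=> le; rewrite /lext (big_fset_incl _ le) //= => k _ /mcoeff_outdom ->.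
by rewrite scale0r.
Qed.

Lemma lext_is_linear (h : K -> V) : linear (lext h).
Proof.
move=> c x y; pose d := (msupp x `|` msupp y)%fset.
have lx : (msupp x `<=` d)%fset by apply: fsubsetUl.
have ly : (msupp y `<=` d)%fset by apply: fsubsetUr.
have lz : (msupp (c *: x + y) `<=` d)%fset.
  apply: fsubset_trans (msuppD_le _ _) _; rewrite fsubUset ly andbT.
  exact: fsubset_trans (msuppZ_le _ _) lx.
rewrite (lextEw _ lx) (lextEw _ ly) (lextEw _ lz) scaler_sumr -big_split /=.
by apply: eq_bigr => k _; rewrite mcoeffD mcoeffZ scalerDl scalerA.
Qed.

HB.instance Definition _ (h : K -> V) :=
  GRing.isLinear.Build F2 {malg F2[K]} V _ (lext h) (lext_is_linear h).

Lemma lextU (h : K -> V) k : lext h << k >> = h k.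
Proof.
rewrite (@lextEw h [fset k]%fset) ?msuppU_le // big_seq_fset1.
by rewrite mcoeffUU scale1r.
Qed.

Lemma malg_scaleU c (k : K) : << c *g k >> = c *: << k >> :> {malg F2[K]}.
Proof.
by apply/malgP => k'; rewrite mcoeffZ !mcoeffU; case: eqP;
  rewrite ?mulr1 ?mulr0.
Qed.

Lemma malg_basis (x : {malg F2[K]}) :
  x = \sum_(k <- msupp x) x@_k *: << k >>.
Proof. by rewrite {1}[x]monalgE; apply: eq_bigr => k _; rewrite malg_scaleU. Qed.

Lemma malg_linext (f g : {linear {malg F2[K]} -> V}) :
  (forall k, f << k >> = g << k >>) -> f =1 g.
Proof.
move=> fg x; rewrite [x]malg_basis !linear_sum /=.
by apply: eq_bigr => k _; rewrite !linearZ /= fg.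
Qed.

End LinearExtension.

(* {malg F2[K1 * K2]} is the tensor product of {malg F2[K1]} and              *)
(* {malg F2[K2]}, with << (a, b) >> = << a >> (x) << b >>.                    *)
Definition tens (K1 K2 : choiceType) (x : {malg F2[K1]}) (y : {malg F2[K2]}) :
    {malg F2[(K1 * K2)%type]} :=
  lext (fun a => lext (fun b => << (a, b) >>) y) x.

Lemma tensE (K1 K2 : choiceType) (x : {malg F2[K1]}) (y : {malg F2[K2]}) a b :
  (tens x y)@_(a, b) = x@_a * y@_b.
Proof.
rewrite /tens /lext raddf_sum /=.
rewrite (eq_bigr (fun k => (x@_k * y@_b) *+ (k == a))); last first.
  move=> k _; rewrite mcoeffZ raddf_sum /= mulr_sumr.
  rewrite (eq_bigr (fun j => (x@_k * y@_j) *+ (k == a) *+ (j == b))); last first.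
    move=> j _; rewrite mcoeffZ mcoeffU xpair_eqE.
    by case: (k == a); case: (j == b); rewrite ?mulr1 ?mulr0.
  have [yb|yb] := boolP (b \in msupp y); last first.
    rewrite (mcoeff_outdom yb) mulr0 mul0rn big_seq big1 // => j jy.
    by have [jb|_] := eqVneq j b; first by rewrite -jb jy in yb.
  rewrite (big_fsetD1 b) //= eqxx big1_fset ?addr0 // => j.
  by rewrite in_fsetD1 => /andP[/negPf-> _].
have [xa|xa] := boolP (a \in msupp x); last first.
  rewrite (mcoeff_outdom xa) mul0r big_seq big1 // => j jx.
  by have [ja|_] := eqVneq j a; first by rewrite -ja jx in xa.
rewrite (big_fsetD1 a) //= eqxx big1_fset ?addr0 // => j.
by rewrite in_fsetD1 => /andP[/negPf-> _].
Qed.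

(* The product monoid, giving {malg F2[K1 * K2]} the ring structure of the    *)
(* tensor product of algebras.                                                *)
Section ProductMonomial.
Variables K1 K2 : monomType.

Definition pair_mone : K1 * K2 := (mone, mone).
Definition pair_mmul (x y : K1 * K2) : K1 * K2 :=
  (mmul x.1 y.1, mmul x.2 y.2).

Fact pair_mmulA : associative pair_mmul.
Proof. by move=> x y z; rewrite /pair_mmul /= !mulmA. Qed.
Fact pair_mmul1m : left_id pair_mone pair_mmul.
Proof. by case=> a b; rewrite /pair_mmul /= !mul1m. Qed.
Fact pair_mmulm1 : right_id pair_mone pair_mmul.
Proof. by case=> a b; rewrite /pair_mmul /= !mulm1. Qed.
Fact pair_munit x y :
  pair_mmul x y = pair_mone -> x = pair_mone /\ y = pair_mone.
Proof.
by case: x y => [a b] [c d] [/unitm[/= -> ->] /unitm[/= -> ->]].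
Qed.

HB.instance Definition _ := Choice_isMonomialDef.Build (K1 * K2)%type
  pair_mmulA pair_mmul1m pair_mmulm1 pair_munit.
End ProductMonomial.

(* Conjugation on a graded connected Hopf algebra {malg F2[K]} with basis K,  *)
(* where the basis vector << k >> has degree deg k.                           *)
Section Conjugation.
Variables (K : choiceType) (deg : K -> nat).
Local Notation H := {malg F2[K]}.
Local Notation HH := {malg F2[(K * K)%type]}.
Variables (unit : H) (mul : H -> H -> H) (coprod : H -> HH).

Definition homogeneous (n : nat) (x : H) : Prop :=
  forall k, k \in msupp x -> deg k = n.

(* The map x' (x) x'' |-> x' chi(x'').                                        *)
Definition mul_id_chi (chi : H -> H) (t : HH) : H :=
  lext (fun p => mul << p.1 >> (chi << p.2 >>)) t.

Definition is_conjugation (chi : {linear H -> H}) : Prop :=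
  chi unit = unit /\
  forall n x, (0 < n)%N -> homogeneous n x -> mul_id_chi chi (coprod x) = 0.

End Conjugation.

Section ConjugationExists.
Variables (K : choiceType) (deg : K -> nat) (e : K).
Local Notation H := {malg F2[K]}.
Local Notation HH := {malg F2[(K * K)%type]}.
Variables (mul : H -> H -> H) (coprod : {linear H -> HH}).
Hypothesis deg0 : forall k, deg k = 0%N -> k = e.
Hypothesis dege : deg e = 0%N.
Hypothesis mul1 : left_id << e >> mul.
Hypothesis coprod_homog : forall k u v,
  (u, v) \in msupp (coprod << k >>) -> (deg u + deg v = deg k)%N.
Hypothesis coprod_counit : forall k v,
  (coprod << k >>)@_(e, v) = (v == k)%:R.

Let coprod_lt k p : p \in (msupp (coprod << k >>) `\ (e, k))%fset ->
  (deg p.2 < deg k)%N.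
Proof.
case: p => u v /=; rewrite in_fsetD1 => /andP[ne uv]; rewrite -(coprod_homog uv).
rewrite -[X in (X < _)%N]add0n ltn_add2r lt0n; apply: contra ne => /eqP/deg0 ue.
move: uv; rewrite ue -mcoeff_neq0 coprod_counit xpair_eqE eqxx /=.
by case: (v == k); rewrite ?eqxx.
Qed.

Let rest (chi : H -> H) k : H :=
  \sum_(p <- (msupp (coprod << k >>) `\ (e, k))%fset)
     (coprod << k >>)@_p *: mul << p.1 >> (chi << p.2 >>).

Let conv_rest (chi : H -> H) k :
  mul_id_chi mul chi (coprod << k >>) = chi << k >> + rest chi k.
Proof.
have ek : (e, k) \in msupp (coprod << k >>).
  by rewrite -mcoeff_neq0 coprod_counit eqxx oner_eq0.
rewrite /mul_id_chi /lext (big_fsetD1 (e, k)) //=.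
by rewrite coprod_counit eqxx scale1r mul1.
Qed.

Lemma conjugation_unique (chi1 chi2 : {linear H -> H}) :
    is_conjugation deg << e >> mul coprod chi1 ->
    is_conjugation deg << e >> mul coprod chi2 ->
  chi1 =1 chi2.
Proof.
move=> [u1 c1] [u2 c2]; apply: malg_linext => k.
have [n] := ubnP (deg k); elim: n k => // n IHn k; rewrite ltnS => kn.
have [/deg0->|k0] := posnP (deg k); first by rewrite u1 u2.
have hk : homogeneous deg (deg k) << k >>.
  by move=> j; rewrite msuppU oner_eq0 in_fset1 => /eqP->.
have E1 : chi1 << k >> + rest chi1 k = 0 by rewrite -conv_rest; exact: c1 hk.
have E2 : chi2 << k >> + rest chi2 k = 0 by rewrite -conv_rest; exact: c2 hk.
have Er : rest chi1 k = rest chi2 k.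
  apply: eq_big_seq => p pk.
  by rewrite IHn // (leq_trans (coprod_lt pk)).
by apply: (addIr (rest chi1 k)); rewrite E1 Er E2.
Qed.

Fixpoint chi_rec (n : nat) (k : K) : H :=
  if n is m.+1 then
    if k == e then << e >> else
    - \sum_(p <- (msupp (coprod << k >>) `\ (e, k))%fset)
        (coprod << k >>)@_p *: mul << p.1 >> (chi_rec m p.2)
  else << e >>.

Let chi_rec_fuel n m k : (deg k < n)%N -> (deg k < m)%N ->
  chi_rec n k = chi_rec m k.
Proof.
elim: n m k => // n IHn [//|m] k; rewrite !ltnS /= => kn km.
case: (k == e); first by [].
apply: (congr1 GRing.opp).
apply: eq_big_seq => p pk.
by have lt := coprod_lt pk; rewrite (IHn m) // (leq_trans lt).
Qed.

Lemma conjugation_exists :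
  exists chi : {linear H -> H}, is_conjugation deg << e >> mul coprod chi.
Proof.
pose chi : {linear H -> H} := lext (fun k => chi_rec (deg k).+1 k).
have chiU k : chi << k >> = chi_rec (deg k).+1 k by exact: lextU.
exists chi; split=> [|n x n0 hx]; first by rewrite chiU /= eqxx.
rewrite [x]malg_basis linear_sum /mul_id_chi linear_sum /=.
rewrite big_seq big1 // => k /hx kn; rewrite !linearZ /=.
rewrite -/(mul_id_chi mul chi _) conv_rest chiU /=.
case: eqP => [ke|_]; first by move: n0; rewrite -kn ke dege.
rewrite (_ : rest chi k = \sum_(p <- (msupp (coprod << k >>) `\ (e, k))%fset)
     (coprod << k >>)@_p *: mul << p.1 >> (chi_rec (deg k) p.2)).
  by rewrite addNr scaler0.
apply: eq_big_seq => p pk.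
by rewrite chiU (chi_rec_fuel (m := deg k)) ?ltnS ?coprod_lt.
Qed.

End ConjugationExists.

Record posn := Posn { posval :> nat; posvalP : (0 < posval)%N }.

HB.instance Definition _ := [isSub for posval].
HB.instance Definition _ := [Choice of posn by <:].

Definition pos_succ (n : nat) : posn := Posn (ltn0Sn n).

(* The mod 2 Leibniz-Hopf algebra: the free algebra is the monoid algebra of  *)
(* the free monoid, and << FMonom I >> is S^I.                                *)
Notation LH := {malg F2[{fmonom posn}]}.
Notation LH2 := {malg F2[({fmonom posn} * {fmonom posn})%type]}.

Definition weight (I : seq posn) : nat := (\sum_(i <- I) val i)%N.

Definition S_gen (n : nat) : LH :=
  if n is m.+1 then << fmu (pos_succ m) >> else 1.

Definition LH_coprod_gen (n : nat) : LH2 :=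
  \sum_(i < n.+1) tens (S_gen i) (S_gen (n - i)).

(* The algebra morphism extending LH_coprod_gen.                              *)
Definition LH_coprod : LH -> LH2 :=
  lext (fun I : {fmonom posn} => \prod_(i <- I) LH_coprod_gen (val i)).

HB.instance Definition _ := GRing.Linear.on LH_coprod.

Definition is_LH_conjugation : {linear LH -> LH} -> Prop :=
  is_conjugation (fun I : {fmonom posn} => weight I) 1 *%R LH_coprod.

(* The reading of a sequence as a string of 1's, of which only the separators *)
(* are kept: true for a comma, false for a plus sign. A nonempty sequence of  *)
(* weight n has n - 1 separators.                                             *)
Fixpoint separators (I : seq posn) : seq bool :=
  if I is i :: J then
    nseq (val i).-1 false ++ (if J is [::] then [::] else true :: separators J)
  else [::].

Fixpoint of_separators (s : seq bool) : seq posn :=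
  match s with
  | [::] => [:: pos_succ 0]
  | true :: s' => pos_succ 0 :: of_separators s'
  | false :: s' =>
      if of_separators s' is j :: J then pos_succ (val j) :: J else [::]
  end.

Definition dual_seq (I : seq posn) : seq posn :=
  if I is [::] then [::] else of_separators (map negb (separators I)).

Definition compositions (n : nat) : seq (seq posn) :=
  if n is m.+1 then [seq of_separators s | s : m.-tuple bool] else [:: [::]].

(* The graded dual, written on the dual basis: << I >> is S_I. The index type *)
(* is the bare seq posn, not the free monoid, so that this carries no         *)
(* concatenation product.                                                     *)
Notation LHdual := {malg F2[seq posn]}.
Notation LHdual2 := {malg F2[(seq posn * seq posn)%type]}.

Definition pairing (f : LH) (x : LHdual) : F2 :=
  \sum_(K <- msupp f) f@_K * x@_(K : seq posn).

Definition pairing2 (f : LH2) (x : LHdual2) : F2 :=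
  \sum_(p <- msupp f) f@_p * x@_(p.1 : seq posn, p.2 : seq posn).

(* The product dual to LH_coprod. Only the S^K with K of weight               *)
(* |I| + |J| can pair nontrivially with S_I S_J; see pairing_mul below.       *)
Definition LHdual_mul_basis (I J : seq posn) : LHdual :=
  \sum_(K <- compositions (weight I + weight J))
    pairing2 (LH_coprod << FMonom K >>) (tens << I >> << J >>) *: << K >>.

Definition LHdual_mul (x y : LHdual) : LHdual :=
  lext (fun I => lext (fun J => LHdual_mul_basis I J) y) x.

Definition LHdual_coprod : LHdual -> LHdual2 :=
  lext (fun I => \sum_(i < (size I).+1) tens << take i I >> << drop i I >>).

HB.instance Definition _ := GRing.Linear.on LHdual_coprod.

Definition is_LHdual_conjugation : {linear LHdual -> LHdual} -> Prop :=
  is_conjugation weight << [::] >> LHdual_mul LHdual_coprod.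

Definition D : LH -> LHdual :=
  lext (fun I : {fmonom posn} => << dual_seq I >>).

HB.instance Definition _ := GRing.Linear.on D.

Lemma pos_succ_pred (i : posn) : pos_succ (val i).-1 = i.
Proof. by apply: val_inj; rewrite /= prednK ?(valP i). Qed.

Lemma pos_ind (P : posn -> Prop) :
  P (pos_succ 0) -> (forall i : posn, P i -> P (pos_succ (val i))) -> forall i, P i.
Proof.
move=> P0 PS i; rewrite -(pos_succ_pred i); elim: (val i).-1 => // n /PS.
by [].
Qed.

Lemma separatorsK I : I != [::] -> of_separators (separators I) = I.
Proof.
elim: I => // i I IHI _ /=.
elim/pos_ind: i => [|i IHi].
  by case: I IHI => //= j J ->.
rewrite -{2}(pos_succ_pred i) in IHi *; move: IHi.
have -> : (val (pos_succ (val i))).-1 = (val i).-1.+1 by rewrite /= prednK ?(valP i).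
by rewrite /= => ->; rewrite /= prednK ?(valP i).
Qed.

Lemma of_separators_neq0 s : of_separators s != [::].
Proof. by elim: s => // -[] s //=; case: (of_separators s). Qed.

Lemma of_separatorsK s : separators (of_separators s) = s.
Proof.
elim: s => // b s; have := of_separators_neq0 s.
case: b => /=; case: (of_separators s) => // j J _ <- //.
by rewrite /= -[in LHS](prednK (valP j)).
Qed.

Lemma dual_seqK : involutive dual_seq.
Proof.
case=> // i I; rewrite [X in dual_seq X]/dual_seq.
set s := separators (i :: I).
have := of_separators_neq0 (map negb s); rewrite /dual_seq.
case E : (of_separators _) => [//|j J] _; rewrite -E of_separatorsK.
by rewrite -map_comp (eq_map negbK) map_id separatorsK.
Qed.

Example dual_seq_132 :
  map val (dual_seq [:: pos_succ 0; pos_succ 2; pos_succ 1]) = [:: 2; 1; 2; 1]%N.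
Proof. by []. Qed.

Lemma D_basis I : D << FMonom I >> = << dual_seq I >>.
Proof. exact: lextU. Qed.

Lemma D_bij : bijective D.
Proof.
pose D' : LHdual -> LH := lext (fun I => << FMonom (dual_seq I) >>).
exists D'; move=> x.
  apply: (malg_linext (f := D' \o D) (g := idfun)) => -[I] /=.
  by rewrite D_basis lextU dual_seqK.
apply: (malg_linext (f := D \o D') (g := idfun)) => I /=.
by rewrite /D' lextU D_basis dual_seqK.
Qed.

Lemma weight_cons i I : weight (i :: I) = (val i + weight I)%N.
Proof. by rewrite /weight big_cons. Qed.

Lemma weight_of_separators s : weight (of_separators s) = (size s).+1.
Proof.
elim: s => [|b s]; first by rewrite /weight big_seq1.
have := of_separators_neq0 s.
case: b => /=; case: (of_separators s) => // j J _; rewrite !weight_cons => IH.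
  by rewrite IH.
by rewrite /= addSn IH.
Qed.

Lemma weight_eq0 I : (weight I == 0%N) = (I == [::]).
Proof.
case: I => [|i I]; first by rewrite /weight big_nil.
by rewrite weight_cons addn_eq0 -leqn0 leqNgt (valP i).
Qed.

Lemma mem_compositions n I : (I \in compositions n) = (weight I == n).
Proof.
case: n => [|n] /=; first by rewrite inE weight_eq0.
apply/imageP/eqP => [[s _ ->]|wI].
  by rewrite weight_of_separators size_tuple.
have I0 : I != [::] by rewrite -weight_eq0 wI.
have sz : size (separators I) == n.
  by rewrite -eqSS -weight_of_separators separatorsK // wI.
by exists (Tuple sz); rewrite //= separatorsK.
Qed.

Lemma compositions_uniq n : uniq (compositions n).
Proof.
case: n => //= n; rewrite map_inj_uniq ?enum_uniq // => s t st.
by apply: val_inj; rewrite /= -(of_separatorsK s) st of_separatorsK.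
Qed.

Lemma LH_coprod_basis I :
  LH_coprod << FMonom I >> = \prod_(i <- I) LH_coprod_gen (val i).
Proof. exact: lextU. Qed.

Lemma mulmalgU (K : monomType) (a b : K) :
  << a >> * << b >> = << mmul a b >> :> {malg F2[K]}.
Proof. by rewrite malgM_def fgmulUU mulr1. Qed.

Lemma mone_nil : mone = FMonom [::] :> {fmonom posn}.
Proof. exact: fmoneE. Qed.

Lemma malg_one (K : monomType) : 1 = << mone >> :> {malg F2[K]}.
Proof. by []. Qed.

Lemma fm_mul I J : mmul (FMonom I) (FMonom J) = FMonom (I ++ J) :> {fmonom posn}.
Proof. exact: fmmulE. Qed.

Lemma LH_coprod1 : LH_coprod 1 = 1.
Proof. by rewrite malg_one mone_nil LH_coprod_basis big_nil. Qed.

Lemma malg_F2scale (K : choiceType) (c : F2) (x : {malg F2[K]}) :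
  c *: x = x *+ c.
Proof. by rewrite -{1}[c]natr_Zp scaler_nat. Qed.

Lemma malg_linM (K L : monomType) (f : {linear {malg F2[K]} -> {malg F2[L]}}) :
  (forall a b, f << mmul a b >> = f << a >> * f << b >>) ->
  {morph f : x y / x * y}.
Proof.
move=> fM x y.
have fE z : f z = \sum_(k <- msupp z) z@_k *: f << k >>.
  rewrite {1}[z]malg_basis linear_sum; apply: eq_bigr => k _.
  by rewrite linearZ.
rewrite [x * y]malgME raddf_sum (fE x) (fE y) mulr_suml; apply: eq_bigr => a _ /=.
rewrite raddf_sum mulr_sumr; apply: eq_bigr => b _ /=.
rewrite malg_scaleU linearZ fM /= !malg_F2scale mulrnAl mulrnAr.
by rewrite -!malg_F2scale scalerA mulrC.
Qed.

Lemma LH_coprodM : {morph LH_coprod : f g / f * g}.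
Proof.
apply: malg_linM => -[I] [J] /=; rewrite fm_mul.
by rewrite !LH_coprod_basis big_cat.
Qed.

Definition homog2 n (t : LH2) := forall u v : {fmonom posn},
  t@_(u, v) != 0 -> (weight u + weight v)%N = n.

Lemma homog2_sum (T : Type) (r : seq T) (F : T -> LH2) n :
  (forall i, homog2 n (F i)) -> homog2 n (\sum_(i <- r) F i).
Proof.
move=> hF u v; rewrite raddf_sum /= => nz; apply/eqP; apply: contraNT nz => ne.
by rewrite big1 // => i _; apply/eqP; apply: contraNT ne => /hF ->.
Qed.

Lemma homog2M m n s t : homog2 m s -> homog2 n t -> homog2 (m + n) (s * t).
Proof.
move=> hs ht u v; rewrite mcoeff_neq0 => /msuppM_le [[u1 v1] [[u2 v2]]].
case=> [ss [st]]; rewrite -mcoeff_neq0 in ss; rewrite -mcoeff_neq0 in st.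
case=> -> ->; rewrite -(hs _ _ ss) -(ht _ _ st) !fmM /weight !big_cat.
by rewrite addnACA.
Qed.

Lemma S_gen_homog n u : (S_gen n)@_u != 0 -> weight u = n.
Proof.
case: n => [|n] /=; first rewrite mcoeff1; last rewrite mcoeffU.
  by case: (eqVneq u) => [-> _|_]; rewrite ?eqxx // fm1 /weight big_nil.
case: (eqVneq _ u) => [<- _|_]; last by rewrite mulr0n eqxx.
by rewrite fmU /weight big_seq1.
Qed.

Lemma LH_coprod_gen_homog n : homog2 n (LH_coprod_gen n).
Proof.
apply: homog2_sum => i u v; rewrite tensE mulf_eq0 negb_or => /andP[].
by move=> /S_gen_homog -> /S_gen_homog ->; rewrite subnKC // -ltnS.
Qed.

Lemma LH_coprod_homog (K : {fmonom posn}) : homog2 (weight K) (LH_coprod << K >>).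
Proof.
case: K => K; rewrite LH_coprod_basis /=; elim: K => [|k K IHK].
  rewrite big_nil => u v; rewrite mcoeff1 xpair_eqE.
  case: andP => [[/eqP-> /eqP->] _|]; rewrite ?eqxx // fm1.
  by rewrite /weight big_nil.
by rewrite big_cons weight_cons; apply: homog2M => //; apply: LH_coprod_gen_homog.
Qed.

Definition counit_l : LH2 -> LH :=
  lext (fun p : {fmonom posn} * {fmonom posn} => if p.1 == mone then << p.2 >> else 0).
HB.instance Definition _ := GRing.Linear.on counit_l.

Lemma counit_lE t v : (counit_l t)@_v = t@_(mone, v).
Proof.
rewrite /counit_l /lext [in RHS](malg_basis t) !raddf_sum /=.
apply: eq_bigr => -[a b] _; rewrite !mcoeffZ mcoeffU xpair_eqE /=.
by case: (a == mone); rewrite ?mcoeffU ?mcoeff0.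
Qed.

Lemma counit_lU (a b : {fmonom posn}) :
  counit_l << (a, b) >> = if a == mone then << b >> else 0.
Proof. exact: lextU. Qed.

Lemma pair_mmulE (K1 K2 : monomType) (a c : K1) (b d : K2) :
  mmul (a, b) (c, d) = (mmul a c, mmul b d).
Proof. by []. Qed.

Lemma counit_lM : {morph counit_l : s t / s * t}.
Proof.
apply: malg_linM => -[a b] [c d] /=.
rewrite pair_mmulE.
apply: (etrans (counit_lU _ _)).
apply: (etrans _ (esym (congr2 *%R (counit_lU _ _) (counit_lU _ _)))).
rewrite [_ == mone](_ : _ = (a == mone) && (c == mone)); last first.
  by apply/eqP/andP => [/unitm[-> ->]//|[/eqP-> /eqP->]]; rewrite mulm1.
by do 2!case: (_ == mone) => /=; rewrite ?mul0r ?mulr0 ?mulmalgU.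
Qed.

Lemma S_gen0 n : (S_gen n)@_mone = (n == 0%N)%:R.
Proof.
case: n => [|n] /=; first by rewrite mcoeff1 eqxx.
by rewrite mcoeffU fm1_eq1.
Qed.

Lemma counit_l_gen n : counit_l (LH_coprod_gen n) = S_gen n.
Proof.
apply/malgP => v; rewrite counit_lE raddf_sum /=.
rewrite big_ord_recl big1 => [|i _]; rewrite tensE S_gen0 ?mul0r //.
by rewrite mul1r subn0 addr0.
Qed.

Lemma LH_coprod_counit (K v : {fmonom posn}) :
  (LH_coprod << K >>)@_(mone, v) = (v == K)%:R.
Proof.
rewrite -counit_lE; case: K => K; rewrite LH_coprod_basis eq_sym -mcoeffU.
congr (mcoeff v _); elim: K => [|k K IHK].
  rewrite big_nil malg_one (_ : mone = (mone, mone)) // counit_lU eqxx.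
  by rewrite mone_nil.
rewrite big_cons counit_lM counit_l_gen IHK -[k in S_gen (val k)]pos_succ_pred /=.
by rewrite mulmalgU pos_succ_pred fmuE fm_mul.
Qed.

Lemma LH_conjugation_exists : exists chi, is_LH_conjugation chi.
Proof.
apply: (conjugation_exists (e := mone)) => //=.
- by move=> [I] /= /eqP; rewrite weight_eq0 => /eqP ->; rewrite mone_nil.
- by rewrite fm1 /weight big_nil.
- exact: mul1r.
- by move=> K u v; rewrite -mcoeff_neq0; apply: LH_coprod_homog.
exact: LH_coprod_counit.
Qed.

Lemma pairingU (K : seq posn) x : pairing << FMonom K >> x = x@_K.
Proof. by rewrite /pairing msuppU1 big_seq_fset1 mcoeffUU mul1r. Qed.

Lemma pairing2U t (I J : seq posn) :
  pairing2 t (tens << I >> << J >>) = t@_(FMonom I, FMonom J).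
Proof.
rewrite /pairing2 [in RHS](malg_basis t) raddf_sum; apply: eq_bigr => -[[u] [v]] _.
rewrite /= tensE mcoeffZ !mcoeffU xpair_eqE !(eq_sym I) !(eq_sym J).
by rewrite -!val_eqE /= -mulnb natrM.
Qed.

Lemma LHdual_mul_basisE I J K :
  (LHdual_mul_basis I J)@_K = (LH_coprod << FMonom K >>)@_(FMonom I, FMonom J).
Proof.
rewrite /LHdual_mul_basis raddf_sum /=.
rewrite (eq_bigr (fun L => (LH_coprod << FMonom K >>)@_(FMonom I, FMonom J)
    *+ (L == K))); last first.
  move=> L _; rewrite pairing2U mcoeffZ mcoeffU.
  by case: eqP => [->|]; rewrite ?mulr1 ?mulr0.
have [Kc|Kc] := boolP (K \in compositions (weight I + weight J)).
  rewrite (bigD1_seq K) ?compositions_uniq //= eqxx big1 ?addr0 //.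
  by move=> L /negPf ->.
rewrite big_seq big1 => [|L Lc]; last first.
  by case: eqP => // LK; rewrite LK (negPf Kc) in Lc.
apply/esym/eqP; apply: contraNT Kc => /LH_coprod_homog /= e.
by rewrite mem_compositions e.
Qed.

Lemma LHdual_mulU I J : LHdual_mul << I >> << J >> = LHdual_mul_basis I J.
Proof. by apply: (etrans (lextU _ _)); apply: lextU. Qed.

Lemma pairing_mul I J K :
  pairing << FMonom K >> (LHdual_mul << I >> << J >>) =
  pairing2 (LH_coprod << FMonom K >>) (tens << I >> << J >>).
Proof. by rewrite LHdual_mulU pairingU LHdual_mul_basisE pairing2U. Qed.

Lemma LHdual_mul1 : left_id << [::] >> LHdual_mul.
Proof.
move=> x; rewrite [RHS](malg_basis x); apply: (etrans (lextU _ _)).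
apply: eq_bigr => J _; congr (_ *: _); apply/malgP => K.
by rewrite LHdual_mul_basisE -mone_nil LH_coprod_counit mcoeffU.
Qed.

Lemma LHdual_coprodE I u v :
  (LHdual_coprod << I >>)@_(u, v) = (I == u ++ v)%:R.
Proof.
apply: (etrans (congr1 (mcoeff _) (lextU _ _))); rewrite raddf_sum /=.
under eq_bigr => i _ do rewrite tensE !mcoeffU -natrM mulnb.
have [->|ne] := eqVneq I (u ++ v); last first.
  rewrite big1 // => i _; case: andP => // -[/eqP iu /eqP iv].
  by rewrite -(cat_take_drop i I) iu iv eqxx in ne.
have lt : (size u < (size (u ++ v)).+1)%N by rewrite ltnS size_cat leq_addr.
rewrite (bigD1 (Ordinal lt)) //= take_size_cat // drop_size_cat // !eqxx /=.
rewrite big1 ?addr0 // => i ne; case: andP => // -[/eqP iu _]; case/eqP: ne.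
by apply: val_inj; rewrite /= -[in RHS]iu size_takel // -ltnS.
Qed.

Lemma LHdual_conjugation_exists : exists chi, is_LHdual_conjugation chi.
Proof.
apply: (conjugation_exists (e := [::])) => /=.
- by move=> I /eqP; rewrite weight_eq0 => /eqP.
- by rewrite /weight big_nil.
- exact: LHdual_mul1.
- move=> I u v; rewrite -mcoeff_neq0 LHdual_coprodE.
  by case: (eqVneq I) => [-> _|]; rewrite ?eqxx // /weight big_cat.
by move=> I v; rewrite LHdual_coprodE eq_sym.
Qed.

Lemma LH_conjugation_unique chi1 chi2 :
  is_LH_conjugation chi1 -> is_LH_conjugation chi2 -> chi1 =1 chi2.
Proof.
apply: (conjugation_unique (e := mone)).
- by move=> [I] /= /eqP; rewrite weight_eq0 => /eqP ->; rewrite mone_nil.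
- exact: mul1r.
- by move=> K u v; rewrite -mcoeff_neq0; apply: LH_coprod_homog.
exact: LH_coprod_counit.
Qed.

Lemma LHdual_conjugation_unique chi1 chi2 :
  is_LHdual_conjugation chi1 -> is_LHdual_conjugation chi2 -> chi1 =1 chi2.
Proof.
apply: (conjugation_unique (e := [::])).
- by move=> I /eqP; rewrite weight_eq0 => /eqP.
- exact: LHdual_mul1.
- move=> I u v; rewrite -mcoeff_neq0 LHdual_coprodE.
  by case: (eqVneq I) => [-> _|]; rewrite ?eqxx // /weight big_cat.
by move=> I v; rewrite LHdual_coprodE eq_sym.
Qed.

(* Main.v *)
From HB Require Import structures.
Require Import Defs.
From mathcomp Require Import all_boot all_order all_algebra.
From mathcomp Require Import finmap.
From mathcomp.multinomials Require Import monalg.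

(** Both conjugations are governed by one symmetric table of coefficients.

    In the free algebra the conjugation is an anti-morphism, and modulo 2 it
    sends S^n to the sum of all S^J with J of weight n.  Hence chi(S^I) is the
    sum of the S^J over the refinements J of the reversal of I
    ([chi_basisE]).  In terms of separators, J refines the reversal of I when
    every comma of reversed I is a comma of J.  Taking the dual of J negates
    its separators, so S^(dual J) occurs in chi(S^I) exactly when I and J
    have equal weight and reversed I has no comma in common with J.  Reversal
    of the whole string exchanges the roles of I and J in this condition, so
      <chi(S^I), S_(dual J)> = <chi(S^J), S_(dual I)>
    ([chi_basis_dual_sym]).

    This symmetry says that D chi D^-1 is the transpose of chi: the
    coefficient of S_K in its value at S_I is that of S^I in chi(S^K)
    ([mcoeff_chi_transport]).  As the product and coproduct of the graded dual
    are the transposes of the coproduct and product of the free algebra, the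
    defining identity of a conjugation for chi at S^K, read off at S^I, is the
    one for D chi D^-1 at S_I, read off at S_K
    ([chi_transport_conjugation]).  Uniqueness of conjugations on both sides
    then gives D chi = chi D, and the statement on invariants follows because
    D is injective. *)

Set Implicit Arguments.
Unset Strict Implicit.
Unset Printing Implicit Defensive.

Import GRing.Theory.

Local Open Scope ring_scope.

(** * Refinements as strings of separators *)

(** A refinement keeps every comma (true) and may turn any plus sign (false)
    into a comma. *)
Fixpoint refinements (s : seq bool) : seq (seq bool) :=
  if s is b :: s' then
    map (cons true) (refinements s') ++
    (if b then [::] else map (cons false) (refinements s'))
  else [:: [::]].

Lemma refinements_cat s1 s2 :
  refinements (s1 ++ s2) =
  [seq t1 ++ t2 | t1 <- refinements s1, t2 <- refinements s2].
Proof.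
elim: s1 => [|b s1 IH] /=; first by rewrite cats0 map_id.
rewrite allpairs_cat allpairs_mapl -map_allpairs -IH; congr (_ ++ _).
by case: b => //; rewrite allpairs_mapl -map_allpairs IH.
Qed.

(** Counting, rather than membership, because refinements are summed: each one
    has to occur exactly once. *)
Lemma count_refinements s t :
  count_mem t (refinements s) = all2 implb s t.
Proof.
elim: s t => [|b s IH] [|c t] //=; rewrite count_cat count_map.
  by case: b => /=; rewrite ?count_map !count_pred0.
case: c.
  rewrite (eq_count (a2 := pred1 t)) ?IH; last first.
    by move=> u /=; rewrite eqseq_cons.
  case: b => /=; rewrite ?addn0 // count_map.
  by rewrite (eq_count (a2 := pred0)) ?count_pred0 ?addn0 //= => u.
rewrite (eq_count (a2 := pred0)) ?count_pred0 //.
case: b => //=; rewrite count_map.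
by rewrite (eq_count (a2 := pred1 t)) ?IH // => u /=; rewrite eqseq_cons.
Qed.

(** Both sides say that the reversal of [s] and the string [t] have the same
    length and are nowhere simultaneously true. *)
Lemma all2_implb_rev_negb s t :
  all2 implb (rev s) (map negb t) = all2 implb (rev t) (map negb s).
Proof.
rewrite -[in RHS](revK s) map_rev; move: (rev s) => {}s.
rewrite !all2E !size_rev !size_map eq_sym.
have [e|//] := eqVneq (size t) (size s); rewrite /= -rev_zip ?size_map //.
rewrite all_rev; elim: s t e => [|b s IH] [|c t] //= [/IH->].
by case: b; case: c.
Qed.

Lemma of_separators_cat s t :
  of_separators (s ++ true :: t) = of_separators s ++ of_separators t.
Proof.
elim: s => [|[] s IH] //=; first by rewrite IH.
by rewrite IH; case: (of_separators s) (of_separators_neq0 s).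
Qed.

Definition refinement_sum (s : seq bool) : LH :=
  \sum_(t <- refinements s) << FMonom (of_separators t) >>.

(** The comma in the middle survives in every refinement and cuts it into
    independent refinements of the two halves. *)
Lemma refinement_sum_cat s t :
  refinement_sum (s ++ true :: t) = refinement_sum s * refinement_sum t.
Proof.
rewrite /refinement_sum refinements_cat big_allpairs_dep mulr_suml.
apply: eq_bigr => u _; rewrite /= cats0 big_map mulr_sumr.
apply: eq_bigr => v _.
by rewrite of_separators_cat mulmalgU fm_mul.
Qed.

Lemma mcoeff_refinement_sum s J : J != [::] ->
  (refinement_sum s)@_(FMonom J) = (all2 implb s (separators J))%:R.
Proof.
move=> J0; rewrite -count_refinements /refinement_sum raddf_sum /=.
rewrite -sum1_count natr_sum [RHS]big_mkcond /=; apply: eq_bigr => u _.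
rewrite mcoeffU -val_eqE /= -{1}(separatorsK J0).
rewrite (can_eq of_separatorsK) eq_sym.
by rewrite [_ == u]eq_sym; case: eqP.
Qed.

Lemma mcoeff_refinement_sum_nil s : (refinement_sum s)@_(FMonom [::]) = 0.
Proof.
rewrite /refinement_sum raddf_sum big1 //= => u _.
by rewrite mcoeffU -val_eqE /= (negPf (of_separators_neq0 u)).
Qed.

(** * The conjugation of the free algebra *)

(** The value of the conjugation on S^n: all compositions of n are refinements
    of the one-term composition (n), whose separators are plus signs only. *)
Definition chi_gen (n : nat) : LH :=
  if n is m.+1 then refinement_sum (nseq m false) else 1.

(** Adding 1 to the first entry, that is, putting a plus sign in front of the
    string of separators. *)
Definition bump_head : LH -> LH :=
  lext (fun I : {fmonom posn} =>
          if val I is j :: J then << FMonom (pos_succ (val j) :: J) >> else 0).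

HB.instance Definition _ := GRing.Linear.on bump_head.

Lemma bump_headM n (x : LH) : bump_head (S_gen n.+1 * x) = S_gen n.+2 * x.
Proof.
rewrite [x]malg_basis !mulr_sumr linear_sum /=; apply: eq_bigr => -[I] _.
rewrite !malg_F2scale !mulrnAr raddfMn /= !fmuE !mulmalgU !fm_mul /=.
by rewrite /bump_head lextU.
Qed.

(** The first separator of a composition of n + 2 is either a comma, so that the
    first entry is 1, or a plus sign. *)
Lemma chi_genS n :
  chi_gen n.+2 = S_gen 1 * chi_gen n.+1 + bump_head (chi_gen n.+1).
Proof.
rewrite /= /refinement_sum /= big_cat !big_map; congr (_ + _).
  by rewrite mulr_sumr; apply: eq_bigr => t _; rewrite fmuE mulmalgU fm_mul.
rewrite linear_sum; apply: eq_bigr => t _; rewrite [RHS]lextU /=.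
by case: (of_separators t) (of_separators_neq0 t).
Qed.

(** Compositions sorted by their first entry.  The induction moves
    [bump_head] through the product, where it affects the first factor
    only. *)
Lemma chi_gen_rec n :
  chi_gen n.+1 = \sum_(i < n.+1) S_gen i.+1 * chi_gen (n - i).
Proof.
elim: n => [|n IH].
  by rewrite big_ord1 mulr1 /= /refinement_sum big_seq1 fmuE.
rewrite chi_genS {2}IH [RHS]big_ord_recl subn0 linear_sum; congr (_ + _).
by apply: eq_bigr => i _; rewrite /= bump_headM subSS.
Qed.

Lemma malg_addrr (K : choiceType) (x : {malg F2[K]}) : x + x = 0.
Proof.
rewrite -mulr2n -scaler_nat (_ : 2%:R = 0 :> F2) ?scale0r //.
exact: val_inj. Qed.

(** The term i = 0 is the sum of all compositions of n; the remaining terms list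
    the same compositions by their first entry, and the two copies cancel
    modulo 2. *)
Lemma chi_gen_conv n : (0 < n)%N ->
  \sum_(i < n.+1) S_gen i * chi_gen (n - i) = 0.
Proof.
case: n => // n _; rewrite big_ord_recl subn0 mul1r.
by rewrite -(chi_gen_rec n) malg_addrr.
Qed.

Definition chi_basis (I : seq posn) : LH := \prod_(i <- rev I) chi_gen (val i).

Lemma chi_basis_cat I J : chi_basis (I ++ J) = chi_basis J * chi_basis I.
Proof. by rewrite /chi_basis rev_cat big_cat. Qed.

Lemma chi_basisE I : I != [::] ->
  chi_basis I = refinement_sum (rev (separators I)).
Proof.
elim: I => // i I IH _; rewrite -cat1s chi_basis_cat {2}/chi_basis big_seq1.
rewrite -{1}(pos_succ_pred i) /=; case: I IH => [|j I] IH.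
  by rewrite cats0 rev_nseq /chi_basis big_nil mul1r.
rewrite IH // -refinement_sum_cat; congr refinement_sum.
by rewrite rev_cat rev_cons rev_nseq cat_rcons.
Qed.

Lemma dual_seq_eq0 I : (dual_seq I == [::]) = (I == [::]).
Proof. by case: I => // i I; apply: negbTE; apply: of_separators_neq0. Qed.

Lemma separators_dual_seq I : separators (dual_seq I) = map negb (separators I).
Proof. by case: I => // i I; rewrite of_separatorsK. Qed.

(** The combinatorial core: the pairing of chi(S^I) with D(S^J) is symmetric in
    I and J. *)
Lemma chi_basis_dual_sym I J :
  (chi_basis I)@_(FMonom (dual_seq J)) = (chi_basis J)@_(FMonom (dual_seq I)).
Proof.
have chi0 K : (chi_basis [::])@_(FMonom (dual_seq K)) = (K == [::])%:R.
  by rewrite /chi_basis big_nil mcoeff1 -val_eqE /= fm1 dual_seq_eq0.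
have chiN K : K != [::] -> (chi_basis K)@_(FMonom [::]) = 0.
  by move=> K0; rewrite chi_basisE // mcoeff_refinement_sum_nil.
have [->|I0] := eqVneq I [::]; have [->|J0] := eqVneq J [::] => //.
- by rewrite chi0 chiN // (negPf J0).
- by rewrite chi0 chiN // (negPf I0).
rewrite !chi_basisE // !mcoeff_refinement_sum ?dual_seq_eq0 //.
by rewrite !separators_dual_seq all2_implb_rev_negb.
Qed.

Definition chi_formula : LH -> LH :=
  lext (fun I : {fmonom posn} => chi_basis I).

HB.instance Definition _ := GRing.Linear.on chi_formula.

Lemma chi_formulaU I : chi_formula << FMonom I >> = chi_basis I.
Proof. exact: lextU. Qed.

Lemma chi_formula_S_gen n : chi_formula (S_gen n) = chi_gen n.
Proof.
case: n => [|n].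
  by rewrite /= {1}malg_one mone_nil chi_formulaU /chi_basis big_nil.
by rewrite /= fmuE chi_formulaU /chi_basis big_seq1.
Qed.

Lemma chi_formulaM (u v : {fmonom posn}) :
  chi_formula << mmul u v >> = chi_formula << v >> * chi_formula << u >>.
Proof. by case: u v => [I] [J]; rewrite fm_mul !chi_formulaU chi_basis_cat. Qed.

Lemma tensU (K1 K2 : choiceType) (a : K1) (b : K2) :
  tens << a >> << b >> = << (a, b) >>.
Proof. by rewrite /tens !lextU. Qed.

(** * Conjugation identities on the basis *)

HB.instance Definition _ (K : choiceType)
    (mul : {malg F2[K]} -> {malg F2[K]} -> {malg F2[K]})
    (chi : {malg F2[K]} -> {malg F2[K]}) :=
  GRing.Linear.copy (mul_id_chi mul chi)
    (lext (fun p => mul << p.1 >> (chi << p.2 >>))).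

Lemma mul_id_chiU (K : choiceType)
    (mul : {malg F2[K]} -> {malg F2[K]} -> {malg F2[K]})
    (chi : {malg F2[K]} -> {malg F2[K]}) (a b : K) :
  mul_id_chi mul chi << (a, b) >> = mul << a >> (chi << b >>).
Proof. exact: lextU. Qed.

Lemma is_conjugation_basis (K : choiceType) (deg : K -> nat)
    (unit : {malg F2[K]}) (mul : {malg F2[K]} -> {malg F2[K]} -> {malg F2[K]})
    (coprod : {linear {malg F2[K]} -> {malg F2[(K * K)%type]}})
    (chi : {linear {malg F2[K]} -> {malg F2[K]}}) :
  chi unit = unit ->
  (forall k, (0 < deg k)%N -> mul_id_chi mul chi (coprod << k >>) = 0) ->
  is_conjugation deg unit mul coprod chi.
Proof.
move=> chi1 conv0; split=> // n x n0 hx.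
rewrite [x]malg_basis [coprod _]linear_sum [LHS]linear_sum big_seq big1 //=.
by move=> k /hx kn; rewrite !linearZ /= conv0 ?kn ?scaler0.
Qed.

Local Notation conv_id_chi := (@mul_id_chi {fmonom posn} *%R chi_formula).

Lemma conv_id_chiMl (u v : {fmonom posn}) (t : LH2) :
  conv_id_chi (<< (u, v) >> * t) =
  << u >> * conv_id_chi t * chi_formula << v >>.
Proof.
rewrite [t]malg_basis mulr_sumr !linear_sum.
rewrite [X in _ = X * _]mulr_sumr [RHS]mulr_suml.
apply: eq_bigr => -[a b] _; rewrite !malg_F2scale mulrnAr !raddfMn /=.
rewrite mulrnAr mulrnAl; congr (_ *+ _).
by rewrite mulmalgU !mul_id_chiU chi_formulaM -mulmalgU !mulrA.
Qed.

Lemma S_gen_basis n : exists u : {fmonom posn}, S_gen n = << u >>.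
Proof. by case: n => [|n]; [exists mone | exists (fmu (pos_succ n))]. Qed.

(** Since the conjugation reverses products, the coproduct of a left factor S^n
    wraps around the value on the remaining factor [t]: its first tensor
    components come out on the left and its second ones, conjugated, on the
    right. *)
Lemma conv_id_chi_gen n (t : LH2) :
  conv_id_chi (LH_coprod_gen n * t) =
  \sum_(i < n.+1) S_gen i * conv_id_chi t * chi_gen (n - i).
Proof.
rewrite /LH_coprod_gen mulr_suml linear_sum; apply: eq_bigr => i _ /=.
rewrite -chi_formula_S_gen.
have [u ->] := S_gen_basis i; have [v ->] := S_gen_basis (n - i).
by rewrite tensU conv_id_chiMl.
Qed.

(** By [conv_id_chi_gen] the value on a nonempty tail is already 0 by induction,
    and only the one-generator case is left, which is [chi_gen_conv]. *)
Lemma conv_id_chi_coprod I :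
  conv_id_chi (LH_coprod << FMonom I >>) = (I == [::])%:R.
Proof.
have c1 : conv_id_chi 1 = 1.
  by rewrite (_ : 1 = << (mone, mone) >> :> LH2) // mul_id_chiU mul1r
    (chi_formula_S_gen 0).
elim: I => [|i I IH]; first by rewrite LH_coprod_basis big_nil c1.
rewrite LH_coprod_basis big_cons -LH_coprod_basis conv_id_chi_gen IH.
case: I {IH} => [|j I]; last by rewrite big1 // => k _; rewrite mulr0 mul0r.
by under eq_bigr do rewrite mulr1; rewrite chi_gen_conv // (valP i).
Qed.

Lemma chi_formula_conjugation : is_LH_conjugation chi_formula.
Proof.
apply: is_conjugation_basis => [|[I] /=]; first exact: (chi_formula_S_gen 0).
by rewrite conv_id_chi_coprod lt0n weight_eq0 => /negPf ->.
Qed.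

(** * The transported conjugation is the transpose *)

Lemma mcoeff_D x K : (D x)@_K = x@_(FMonom (dual_seq K)).
Proof.
rewrite [x]malg_basis linear_sum !raddf_sum; apply: eq_bigr => -[I] _ /=.
rewrite linearZ /= D_basis !mcoeffZ !mcoeffU -val_eqE /=.
by rewrite (can2_eq dual_seqK dual_seqK).
Qed.

(** This is D chi D^-1. *)
Definition chi_transport : LHdual -> LHdual :=
  lext (fun I => D (chi_basis (dual_seq I))).
HB.instance Definition _ := GRing.Linear.on chi_transport.

Lemma chi_transportU I : chi_transport << I >> = D (chi_basis (dual_seq I)).
Proof. exact: lextU. Qed.

Lemma mcoeff_chi_transport I K :
  (chi_transport << I >>)@_K = (chi_basis K)@_(FMonom I).
Proof. by rewrite chi_transportU mcoeff_D chi_basis_dual_sym dual_seqK. Qed.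

Lemma sum_splittings (I u v : seq posn) :
  \sum_(i < (size I).+1) (u == take i I)%:R * (v == drop i I)%:R
  = (I == u ++ v)%:R :> F2.
Proof.
rewrite -LHdual_coprodE [LHdual_coprod _]lextU raddf_sum /=.
by apply: eq_bigr => i _; rewrite tensE !mcoeffU eq_sym [v == _]eq_sym.
Qed.

(** Concatenation is dual to deconcatenation. *)
Lemma mcoeff_mulU (u : {fmonom posn}) (y : LH) I :
  (<< u >> * y)@_(FMonom I) =
  \sum_(i < (size I).+1) (val u == take i I)%:R * y@_(FMonom (drop i I)).
Proof.
rewrite [y]malg_basis mulr_sumr raddf_sum /=.
under [RHS]eq_bigr => i _ do rewrite raddf_sum mulr_sumr.
rewrite exchange_big /=; apply: eq_bigr => v _.
rewrite [in LHS]malg_F2scale mulrnAr mulmalgU -malg_F2scale mcoeffZ mcoeffU.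
rewrite -[mmul u v == _]val_eqE /= fmM eq_sym -sum_splittings mulr_sumr.
apply: eq_bigr => i _.
by rewrite mcoeffZ mcoeffU -[v == _]val_eqE mulrCA.
Qed.

(** The product of the dual is dual to the coproduct.  The sum runs over the
    support of the coproduct instead of that of [y], to be compared term by
    term with a convolution in the free algebra. *)
Lemma mcoeff_LHdual_mulU (I K : seq posn) (y : LHdual) :
  (LHdual_mul << I >> y)@_K =
  \sum_(p <- msupp (LH_coprod << FMonom K >>))
    (LH_coprod << FMonom K >>)@_p * ((val p.1 == I)%:R * y@_(val p.2)).
Proof.
rewrite /LHdual_mul lextU /lext raddf_sum /=.
under eq_bigr => J _ do rewrite mcoeffZ LHdual_mul_basisE.
move: (LH_coprod _) => t; rewrite [t]malg_basis.
under eq_bigr => J _ do rewrite raddf_sum mulr_sumr.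
rewrite exchange_big -malg_basis; apply: eq_bigr => -[u v] _ /=.
rewrite [in RHS](malg_basis y) raddf_sum !mulr_sumr; apply: eq_bigr => J _ /=.
rewrite !mcoeffZ !mcoeffU xpair_eqE -!val_eqE /= [J == _]eq_sym.
by rewrite -mulnb natrM mulrCA; congr (_ * _); rewrite mulrCA.
Qed.

(** The coefficient at S_K of the convolution on S_I is rewritten, by the two
    preceding dualities, into the coefficient at S^I of the convolution of the
    identity with chi on S^K, which vanishes as I is nonempty. *)
Lemma chi_transport_conjugation : is_LHdual_conjugation chi_transport.
Proof.
apply: is_conjugation_basis => [|I wI] /=.
  by rewrite [LHS]chi_transportU /chi_basis big_nil malg_one mone_nil D_basis.
apply/malgP => K; rewrite mcoeff0 [LHdual_coprod _]lextU linear_sum raddf_sum.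
transitivity ((conv_id_chi (LH_coprod << FMonom K >>))@_(FMonom I)); last first.
  rewrite conv_id_chi_coprod; case: eqP => _; last by rewrite mcoeff0.
  by rewrite mcoeff1 -val_eqE /= fm1 -weight_eq0 eqn0Ngt wI.
under eq_bigr => i _ do rewrite tensU /= mul_id_chiU mcoeff_LHdual_mulU.
rewrite exchange_big [mul_id_chi _ _ _]/lext raddf_sum /=.
apply: eq_bigr => -[u v] _; rewrite mcoeffZ mcoeff_mulU mulr_sumr.
apply: eq_bigr => i _ /=; rewrite mcoeff_chi_transport; case: v => v.
by rewrite [chi_formula _]chi_formulaU.
Qed.

Theorem theorem6p3
    (chi_LH : {linear LH -> LH}) (chi_LHdual : {linear LHdual -> LHdual})
    (h_LH : is_LH_conjugation chi_LH)
    (h_LHdual : is_LHdual_conjugation chi_LHdual) :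
  D \o chi_LH =1 chi_LHdual \o D /\
  (forall f : LH, chi_LH f = f <-> chi_LHdual (D f) = D f).
Proof.
have eLH := LH_conjugation_unique h_LH chi_formula_conjugation.
have eLHdual := LHdual_conjugation_unique h_LHdual chi_transport_conjugation.
have comm : D \o chi_LH =1 chi_LHdual \o D.
  apply: (malg_linext (f := D \o chi_LH) (g := chi_LHdual \o D)) => -[I] /=.
  rewrite eLH eLHdual D_basis [RHS]chi_transportU dual_seqK.
  by congr D; apply: chi_formulaU.
split=> // f; have /= <- := comm f; split=> [->//|].
exact: (bij_inj D_bij).
Qed.
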